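(* Let $m>2$ be an integer with prime factorization $m=p_1^{\alpha_1}\cdots p_r^{\alpha_r}$ ($p_1,\ldots,p_r$ distinct primes, $\alpha_i\ge1$), and let $p$ be an odd prime not dividing $m$. Then $$(-1)^{\frac{\varphi(m)}2\cdot\frac{p-1}2}\Big(\frac{p_1}p\Big)^{[r=1]}\prod_{\substack{0<k<m/2\\ \gcd(k,m)=1}}\binom{p-1}{\lfloor pk/m\rfloor}\equiv 1+\frac{\varphi(m)}2\sum_{i=1}^r(\alpha_ip_i-\alpha_i+1)\frac{p_i^{p-1}-1}{p_i-1}\pmod{p^2}.$$
   Context: $\varphi$ is Euler's totient function, $(\frac{\cdot}{p})$ is the Legendre symbol, $\lfloor x\rfloor$ is the integer part of $x$, and for an assertion $P$, $[P]=1$ if $P$ holds and $[P]=0$ otherwise. Congruences modulo $p^2$ are between rational numbers whose denominators are prime to $p$. *)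

(* Defs.v *)
From mathcomp Require Import all_boot all_order all_algebra.
Set Implicit Arguments. Unset Strict Implicit. Unset Printing Implicit Defensive.
Import GRing.Theory Num.Theory.

Definition legendre (a p : nat) : int :=
  if p %| a then 0%R
  else if [exists x : 'I_p, (x * x) %% p == a %% p] then 1%R else (-1)%R.

(* Main.v *)
Require Import Defs.
From mathcomp Require Import all_boot all_order all_algebra.
From mathcomp Require Import cyclic.
From mathcomp Require Import zify ring.
Import GRing.Theory Num.Theory.

(** Write [F m] for the product of all ['C(p-1, floor(pk/m))] with [k < m]
    prime to [m], and [H m] for the half product [k < m/2], so that
    [F m = (H m)^2].  Grouping [k < m] by [m / gcd(k, m)] turns products over
    all [k < m] into products of [F d] over the divisors [d] of [m], so an
    identity for the former determines [F] by Moebius inversion.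

    Modulo [p^2], ['C(p-1, j) = (-1)^j (1 - p H_j)] with [H_j] the harmonic
    numbers; exchanging summations and Lerch's congruence
    [p * sum_i floor(mi/p) / i = m (m^(p-1) - 1)] evaluate the square of the
    full product, hence [F m]^2 = [H m]^4.  Since [H m] is a sign times
    [1 + p y], this determines [H m] up to that sign,
    [(-1)^(sum floor(pk/m))].

    The sign is computed in ['F_p]: counting lattice points exchanges
    [floor(pk/m)] for [floor(mj/p)], whose sum has its parity given by Gauss's
    lemma, and the product of the exponential of the von Mangoldt function
    over the divisors of [m] is [m]; this is why a Legendre symbol remains
    exactly when [m] is a prime power. *)

(** * Divisors and Moebius inversion *)

Lemma perm_divisors_prime_pow q a n : prime q -> coprime q n -> 0 < n ->
  perm_eq (divisors (q ^ a.+1 * n))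
          (divisors (q ^ a * n) ++ [seq q ^ a.+1 * e | e <- divisors n]).
Proof.
move=> q_pr co_qn n_gt0; have q_gt0 := prime_gt0 q_pr.
have qX_gt0 b : 0 < q ^ b by rewrite expn_gt0 q_gt0.
have pos b : 0 < q ^ b * n by rewrite muln_gt0 qX_gt0.
have inj_q : injective (muln (q ^ a.+1)).
  by move=> x y /eqP; rewrite eqn_pmul2l // => /eqP.
apply: uniq_perm => [||d]; first exact: divisors_uniq.
  rewrite cat_uniq divisors_uniq map_inj_uniq // divisors_uniq andbT /=.
  apply/hasPn => _ /mapP[e _ ->]; rewrite /= -dvdn_divisors //.
  apply/negP => /(dvdn_trans (dvdn_mulr e (dvdnn _))).
  by rewrite Gauss_dvdl ?coprimeXl // dvdn_Pexp2l ?prime_gt1 // ltnn.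
rewrite mem_cat -!dvdn_divisors //; apply/idP/orP => [dv|[|/mapP[e]]].
- have [qa|nqa] := boolP (q ^ a.+1 %| d).
    right; case/dvdnP: qa dv => e ->; rewrite mulnC dvdn_pmul2l // => e_n.
    by rewrite map_f // -dvdn_divisors.
  left; have d_gt0 := dvdn_gt0 (pos _) dv.
  have [w co_qw dE] := pfactor_coprime q_pr d_gt0.
  rewrite dE mulnC Gauss_dvd ?coprimeXl //.
  rewrite dvdn_mulr ?dvdn_exp2l //=; last by rewrite -ltnS ltnNge -pfactor_dvdn.
  rewrite dvdn_mull // -(@Gauss_dvdr _ (q ^ a.+1)).
    by apply: dvdn_trans dv; rewrite [d in _ %| d]dE dvdn_mulr.
  by rewrite coprime_sym coprimeXl.
- by move=> dv; apply: dvdn_trans dv _; rewrite dvdn_mul ?dvdn_exp2l.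
by rewrite -dvdn_divisors // => e_n ->; rewrite dvdn_pmul2l.
Qed.

(** Reducing [k / m] to lowest terms sorts the [k] by denominator [d]; the hypothesis on [g] makes
    it a function of the fraction. The class of [d] consists of the [j * (m %/ d)] with [j] prime to
    [d]. *)
Lemma big_gcd_classes (T : Type) (idx : T) (op : Monoid.com_law idx)
    (g : nat -> nat -> T) (m : nat) :
  (forall c k n, 0 < c -> g (k * c) (n * c) = g k n) -> 0 < m ->
  \big[op/idx]_(1 <= k < m) g k m =
  \big[op/idx]_(d <- divisors m) \big[op/idx]_(1 <= k < d | coprime k d) g k d.
Proof.
move=> gE m_gt0.
transitivity (\big[op/idx]_(1 <= k < m)
                \big[op/idx]_(d <- divisors m | m %/ gcdn k m == d) g k m).
  apply: eq_bigr => k _.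
  rewrite -big_filter (@eq_filter _ _ (pred1 (m %/ gcdn k m))); last first.
    by move=> d /=; rewrite eq_sym.
  rewrite filter_pred1_uniq ?divisors_uniq ?big_seq1 //.
  by rewrite -dvdn_divisors // dvdn_divLR ?dvdn_gcdr ?dvdn_mulr // gcdn_gt0 m_gt0 orbT.
rewrite (exchange_big_dep xpredT) //= big_seq [RHS]big_seq; apply: eq_bigr => d.
rewrite -dvdn_divisors // => d_m; have d_gt0 := dvdn_gt0 m_gt0 d_m.
have c_gt0 : 0 < m %/ d by rewrite divn_gt0 // dvdn_leq.
rewrite -big_filter -[RHS]big_filter.
rewrite (perm_big [seq k * (m %/ d) | k <- index_iota 1 d & coprime k d]) /=.
  rewrite big_map; apply: eq_bigr => k _.
  by rewrite -(gE (m %/ d) k d c_gt0) [d * _]mulnC divnK.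
apply: uniq_perm => [||k].
- by rewrite filter_uniq ?iota_uniq.
- rewrite map_inj_uniq ?filter_uniq ?iota_uniq // => x y /eqP.
  by rewrite eqn_pmul2r // => /eqP.
rewrite mem_filter mem_index_iota; apply/andP/mapP => [[/eqP dE /andP[k_gt0 k_m]]|].
  have g_gt0 : 0 < gcdn k m by rewrite gcdn_gt0 k_gt0.
  have cE : m %/ d = gcdn k m.
    by rewrite -dE -{1}(divnK (dvdn_gcdr k m)) mulKn // divn_gt0 // dvdn_leq ?dvdn_gcdr.
  exists (k %/ gcdn k m); last by rewrite cE divnK ?dvdn_gcdl.
  rewrite mem_filter mem_index_iota divn_gt0 // dvdn_leq ?dvdn_gcdl //=.
  rewrite -[d in _ < d]dE ltn_divLR // divnK ?dvdn_gcdr // k_m andbT -dE.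
  by rewrite /coprime -(eqn_pmul2r g_gt0) muln_gcdl !divnK ?dvdn_gcdl ?dvdn_gcdr // mul1n.
case=> j; rewrite mem_filter mem_index_iota => /and3P[co_jd j_gt0 j_d] ->.
set c := m %/ d in c_gt0 *; have mE : m = d * c by rewrite mulnC divnK.
rewrite muln_gt0 j_gt0 c_gt0 {3}mE ltn_pmul2r // j_d; split=> //.
by rewrite mE -muln_gcdl (eqP co_jd) mul1n mulnK.
Qed.

(** Moebius inversion without the Moebius function: by strong induction the factors at proper
    divisors agree, and being units they cancel. [P] will be coprimality to [p]. *)
Lemma prod_divisors_inj (R : comUnitRingType) (P : pred nat) (f g : nat -> R) :
  (forall m d, P m -> d %| m -> P d) ->
  (forall m, P m -> 0 < m -> g m \is a GRing.unit) ->
  (forall m, P m -> 0 < m ->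
     (\prod_(d <- divisors m) f d = \prod_(d <- divisors m) g d)%R) ->
  forall m, P m -> 0 < m -> f m = g m.
Proof.
move=> Pdvd g_unit fg; elim/ltn_ind => m IHm Pm m_gt0.
have := fg m Pm m_gt0; rewrite !(bigD1_seq m) ?divisors_id ?divisors_uniq //=.
have Udiv d : d %| m -> d != m -> f d = g d.
  move=> d_m ne_dm; apply: IHm (Pdvd _ _ Pm d_m) (dvdn_gt0 m_gt0 d_m).
  by rewrite ltn_neqAle ne_dm dvdn_leq.
rewrite big_seq_cond [in RHS]big_seq_cond.
under eq_bigr => d /andP[d_m ne_dm] do rewrite Udiv ?dvdn_divisors //.
apply: GRing.mulIr; apply: rpred_prod => d /andP[d_m _].
move: d_m; rewrite -dvdn_divisors // => d_m.
exact: g_unit (Pdvd _ _ Pm d_m) (dvdn_gt0 m_gt0 d_m).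
Qed.

(** * Arithmetic functions with known products or sums over divisors *)

Definition exp_mangoldt (d : nat) : nat :=
  if size (primes d) == 1 then head 0 (primes d) else 1.

Lemma exp_mangoldt_prime_pow q a : prime q -> exp_mangoldt (q ^ a.+1) = q.
Proof. by move=> q_pr; rewrite /exp_mangoldt primesX // primes_prime. Qed.

Lemma exp_mangoldt_two_primes q a e :
  prime q -> coprime q e -> 1 < e -> exp_mangoldt (q ^ a.+1 * e) = 1.
Proof.
move=> q_pr co_qe e_gt1; rewrite /exp_mangoldt.
case: ifP => // /eqP/esym sz1; have e_gt0 := ltnW e_gt1.
have qX_gt0 : 0 < q ^ a.+1 by rewrite expn_gt0 prime_gt0.
have in_q : q \in primes (q ^ a.+1 * e).
  by rewrite primesM // primesX // primes_prime // mem_seq1 eqxx.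
have in_r : pdiv e \in primes (q ^ a.+1 * e).
  by rewrite primesM // [in X in _ || X]mem_primes pdiv_prime // e_gt0 pdiv_dvd orbT.
case: (primes _) sz1 in_q in_r => [|x [|//]] // _; rewrite !mem_seq1 => /eqP <- /eqP qE.
by move: co_qe; rewrite prime_coprime // -qE pdiv_dvd.
Qed.

Lemma prime_pow_split n : 1 < n ->
  exists q a k, [/\ prime q, coprime q k, n = q ^ a.+1 * k & 0 < k < n].
Proof.
move=> n_gt1; have n_gt0 := ltnW n_gt1; have q_pr := pdiv_prime n_gt1.
have [k co_qk nE] := pfactor_coprime q_pr n_gt0.
have v_gt0 : 0 < logn (pdiv n) n by rewrite logn_gt0 mem_primes q_pr n_gt0 pdiv_dvd.
have k_gt0 : 0 < k by case: (k) nE n_gt0 => // ->.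
exists (pdiv n), (logn (pdiv n) n).-1, k; rewrite prednK // [_ * k]mulnC; split=> //.
by rewrite k_gt0 {1}nE ltn_Pmulr // -(expn0 (pdiv n)) ltn_exp2l // prime_gt1.
Qed.

(** Raising the exponent of [q] to [b.+1] adds the divisors [q ^ b.+1 * e] with [e] dividing [k];
    only [e = 1] gives a prime power, contributing one factor [q]. *)
Lemma prod_exp_mangoldt n :
  0 < n -> \prod_(d <- divisors n) exp_mangoldt d = n.
Proof.
elim/ltn_ind: n => n IHn n_gt0.
have [n_le1|n_gt1] := leqP n 1.
  have -> : n = 1 by apply/eqP; rewrite eqn_leq n_le1.
  by rewrite big_seq1.
have [q [a [k [q_pr co_qk nE /andP[k_gt0 k_lt]]]]] := prime_pow_split n n_gt1.
rewrite nE {nE}; elim: a.+1 => [|b IHb]; first by rewrite mul1n IHn.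
rewrite (perm_big _ (perm_divisors_prime_pow q b k q_pr co_qk k_gt0)) /=.
rewrite big_cat /= IHb big_map (bigD1_seq 1) ?divisor1 ?divisors_uniq //=.
rewrite muln1 exp_mangoldt_prime_pow // big_seq_cond big1 ?muln1.
  by rewrite mulnC mulnA -expnS.
move=> e; rewrite -dvdn_divisors // => /andP[e_k e_neq1].
rewrite exp_mangoldt_two_primes //; first exact: coprime_dvdr e_k co_qk.
by rewrite ltn_neqAle eq_sym e_neq1 (dvdn_gt0 k_gt0 e_k).
Qed.

Lemma sum_totient_divisors n : 0 < n -> \sum_(d <- divisors n) totient d = n.
Proof.
move=> n_gt0; rewrite -[RHS]sum_totient_dvd -(big_mkord (dvdn^~ n) totient).
rewrite -[RHS]big_filter; apply: perm_big; apply: uniq_perm.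
- exact: divisors_uniq.
- by rewrite filter_uniq ?iota_uniq.
move=> d; rewrite mem_filter mem_index_iota -dvdn_divisors //=.
by case d_n: (d %| n) => //=; rewrite ltnS dvdn_leq.
Qed.

(* The Moebius transform of [n |-> n * logn q n]; it equals
   [phi(m) (v + 1/(q-1))] with [v = logn q m] when [q] divides [m], else [0]. *)
Definition totient_logn (q m : nat) : nat :=
  let v := logn q m in
  totient (m %/ q ^ v) * (v * q ^ v - v.-1 * q ^ v.-1).

Lemma totient_logn_pow q a e : prime q -> coprime q e -> 0 < e ->
  totient_logn q (q ^ a * e) = totient e * (a * q ^ a - a.-1 * q ^ a.-1).
Proof.
move=> q_pr co_qe e_gt0; rewrite /totient_logn.
have qX_gt0 : 0 < q ^ a by rewrite expn_gt0 prime_gt0.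
have -> : logn q (q ^ a * e) = a.
  by rewrite lognM // pfactorK // (logn_coprime co_qe) addn0.
by rewrite mulKn.
Qed.

(** The divisors gained when the exponent of [q] rises to [b.+1] contribute
    [k * (b.+1 * q ^ b.+1 - b * q ^ b)], since the totients over the divisors of [k] add up to [k];
    these increments telescope. *)
Lemma sum_totient_logn q n : prime q -> 0 < n ->
  \sum_(d <- divisors n) totient_logn q d = n * logn q n.
Proof.
move=> q_pr n_gt0; have [k co_qk ->] := pfactor_coprime q_pr n_gt0.
set v := logn q n; have k_gt0 : 0 < k by case: k co_qk => //; case: (q) q_pr => [|[]].
have qX_gt0 : 0 < q ^ v by rewrite expn_gt0 prime_gt0.
rewrite lognM // pfactorK // logn_coprime // add0n [k * _]mulnC.
elim: v {qX_gt0} => [|b IHb].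
  rewrite mul1n muln0 big_seq big1 // => d; rewrite -dvdn_divisors // => d_k.
  rewrite -[d]mul1n -(expn0 q) totient_logn_pow ?muln0 //.
    exact: coprime_dvdr d_k co_qk.
  exact: dvdn_gt0 d_k.
rewrite (perm_big _ (perm_divisors_prime_pow q b k q_pr co_qk k_gt0)) /=.
rewrite big_cat /= IHb big_map.
rewrite (_ : \sum_(e <- _) _ =
  \sum_(e <- divisors k) totient e * (b.+1 * q ^ b.+1 - b * q ^ b)).
  rewrite -big_distrl /= sum_totient_divisors //.
  have : b * q ^ b <= b.+1 * q ^ b.+1.
    by rewrite leq_mul // leq_exp2l // prime_gt1.
  move: (q ^ b.+1) (q ^ b) => x y; nia.
rewrite big_seq [RHS]big_seq; apply: eq_bigr => e; rewrite -dvdn_divisors // => e_k.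
rewrite totient_logn_pow //; first exact: coprime_dvdr e_k co_qk.
exact: dvdn_gt0 e_k.
Qed.

(** Turns the summands of the theorem into [totient_logn]: the factor [q - 1] in the totient of a
    power of [q] clears the denominator, and the division is exact. *)
Lemma totient_logn_fermat q m k : q \in primes m ->
  totient m * ((logn q m * q - logn q m + 1) * ((q ^ k - 1) %/ (q - 1))) =
  totient_logn q m * (q ^ k - 1).
Proof.
rewrite mem_primes => /and3P[q_pr m_gt0 q_m].
have q_gt1 := prime_gt1 q_pr.
have v_gt0 : 0 < logn q m by rewrite logn_gt0 mem_primes q_pr m_gt0.
have [e co_qe mE] := pfactor_coprime q_pr m_gt0.
have e_gt0 : 0 < e by case: (e) mE m_gt0 => // ->.
move: mE; case: (logn q m) v_gt0 => // a _ ->.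
rewrite mulnC [in totient_logn _ _]mulnC totient_logn_pow //.
rewrite [e * _]mulnC totient_coprime ?coprimeXl // totient_pfactor //=.
have /dvdnP[w wE] : q - 1 %| q ^ k - 1.
  by rewrite -{2}(exp1n k) subn_exp dvdn_mulr.
rewrite wE mulnK ?subn_gt0 // -subn1 expnS.
have -> : a.+1 * (q * q ^ a) - a * q ^ a = (a.+1 * q - a.+1 + 1) * q ^ a.
  by rewrite mulnA -mulnBl; congr (_ * _); nia.
by ring.
Qed.

(** * Lattice points and residues modulo [p] *)

Lemma sum_const_gt (V : nmodType) (x : V) (M c : nat) :
  (\sum_(1 <= k < M.+1 | (c < k)%N) x = x *+ (M - c))%R.
Proof.
rewrite big_mkcond /=; elim: M => [|M IHM]; first by rewrite big_geq.
rewrite big_nat_recr //= IHM ltnS; case: leqP => [le_cM|lt_Mc].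
  by rewrite subSn // mulrSr.
by rewrite addr0 (eqP (ltnW lt_Mc : M - c == 0)) (eqP (lt_Mc : M.+1 - c == 0)).
Qed.

(* Both sides sum [a i] over the lattice points [(k, i)] with
   [1 <= k <= M], [1 <= i <= I] and [i / p < k / m]. *)
Lemma sum_lattice (V : nmodType) (a : nat -> V) (m p M I : nat) :
  prime p -> coprime p m -> 0 < m -> I < p ->
  (forall k, k <= M -> (p * k) %/ m <= I) ->
  (\sum_(1 <= k < M.+1) \sum_(1 <= i < ((p * k) %/ m)%N.+1) a i =
   \sum_(1 <= i < I.+1) a i *+ (M - (m * i) %/ p)%N)%R.
Proof.
move=> p_pr co_pm m_gt0 I_p kI; have p_gt0 := prime_gt0 p_pr.
transitivity (\sum_(1 <= k < M.+1) \sum_(1 <= i < I.+1 | (i <= (p * k) %/ m)%N) a i)%R.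
  rewrite big_nat_cond [RHS]big_nat_cond; apply: eq_bigr => k /andP[/andP[_ k_M] _].
  by rewrite (@big_nat_widen _ _ _ 1 ((p * k) %/ m).+1 I.+1) //= ltnS kI.
rewrite (exchange_big_dep xpredT) //= big_nat_cond [RHS]big_nat_cond.
apply: eq_bigr => i /andP[/andP[i_gt0 i_I] _]; rewrite -sum_const_gt.
apply: eq_bigl => k; rewrite leq_divRL // ltn_divLR // ltn_neqAle.
(* [m * i = p * k] is impossible for [0 < i < p]: no lattice point lies on the line. *)
rewrite [i * m]mulnC [k * p]mulnC; case: eqP => //= mi_pk.
have: p %| m * i by rewrite mi_pk dvdn_mulr.
rewrite Gauss_dvdr // => /(dvdn_leq i_gt0).
by rewrite leqNgt (leq_trans i_I).
Qed.

Lemma perm_map_stable (T : eqType) (f : T -> T) (s : seq T) :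
  uniq s -> {in s &, injective f} -> {in s, forall x, f x \in s} ->
  perm_eq (map f s) s.
Proof.
move=> Us inj_f fs; have Uf : uniq (map f s) by rewrite map_inj_in_uniq.
have sub : {subset map f s <= s} by move=> _ /mapP[x x_s ->]; apply: fs.
have le_sz : size s <= size (map f s) by rewrite size_map.
by apply: uniq_perm => //; have [] := uniq_min_size Uf sub le_sz.
Qed.

Lemma perm_mul_mod p m : prime p -> coprime p m ->
  perm_eq [seq (m * i) %% p | i <- index_iota 1 p] (index_iota 1 p).
Proof.
move=> p_pr co_pm; have p_gt0 := prime_gt0 p_pr.
have inj : {in index_iota 1 p &, injective (fun i => (m * i) %% p)}.
  have le_inj i j : i <= j -> j < p -> (m * i) %% p = (m * j) %% p -> i = j.
    move=> le_ij j_p /esym/eqP; rewrite eqn_mod_dvd ?leq_mul2l ?le_ij ?orbT //.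
    rewrite -mulnBr Gauss_dvdr // => dv; apply/eqP; rewrite eqn_leq le_ij -subn_eq0.
    apply/eqP; case: (posnP (j - i)) => // /dvdn_leq/(_ dv); rewrite leqNgt.
    by rewrite (leq_ltn_trans (leq_subr _ _)).
  move=> i j; rewrite !mem_index_iota => /andP[_ i_p] /andP[_ j_p] ij.
  by case: (leqP i j) => [|/ltnW] /le_inj->.
apply: perm_map_stable inj _; first exact: iota_uniq.
move=> i; rewrite mem_index_iota => /andP[i_gt0 i_p].
rewrite mem_index_iota ltn_pmod // andbT lt0n -/(dvdn _ _) Gauss_dvdr //.
by apply/negP => /(dvdn_leq i_gt0); rewrite leqNgt i_p.
Qed.

(** * Computations modulo [p ^ 2] *)

Lemma prod_Dsq0 (R : comPzRingType) (t : R) (I : Type) (s : seq I) (P : pred I) (x : I -> R) :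
  (t * t = 0 -> \prod_(i <- s | P i) (1 + t * x i) = 1 + t * \sum_(i <- s | P i) x i)%R.
Proof.
move=> tt; elim/big_rec2: _ => [|i y z _ ->]; first by rewrite mulr0 addr0.
by rewrite mulrDr mulr1 mulrDl mul1r mulrACA tt mul0r addr0 mulrDr addrA addrAC.
Qed.

Lemma coprime_prime_gt0 p q : prime p -> coprime p q -> 0 < q.
Proof. by case: q => // p_pr; rewrite /coprime gcdn0; case: p p_pr => [|[]]. Qed.

(* In the intended model [R] is [Z/p^2], where [p * p = 0]. *)
Section ModSquare.
Variables (R : comUnitRingType) (p : nat).
Hypotheses (p_pr : prime p) (p_odd : odd p).
Hypothesis pp0 : (p%:R * p%:R = 0 :> R)%R.
Hypothesis natU : forall i, coprime p i -> (i%:R : R)%R \is a GRing.unit.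

Local Open Scope ring_scope.
Notation t := (p%:R : R).

Let p_gt0 := prime_gt0 p_pr.

Let natU_lt i : (0 < i < p)%N -> (i%:R : R) \is a GRing.unit.
Proof.
move=> /andP[i_gt0 i_p]; apply: natU; rewrite prime_coprime //.
by apply/negP => /(dvdn_leq i_gt0); rewrite leqNgt i_p.
Qed.

Definition harmonic (j : nat) : R := \sum_(1 <= i < j.+1) i%:R^-1.

(** The ratio of consecutive coefficients is [(p - (j + 1)) / (j + 1) = - (1 - p / (j + 1))], so
    each step flips the sign and adds [1 / (j + 1)] to the harmonic number. *)
Lemma bin_pred_prime j : (j < p)%N ->
  'C(p.-1, j)%:R = (-1) ^+ j * (1 - t * harmonic j).
Proof.
elim: j => [|j IHj] j_p.
  by rewrite bin0 /harmonic big_geq // mulr0 subr0 expr0 mulr1.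
have U : (j.+1%:R : R) \is a GRing.unit by apply: natU_lt.
apply: (mulrI U); rewrite -natrM mul_bin_left natrM IHj 1?ltnW //.
have -> : (p.-1 - j)%N%:R = t - j.+1%:R.
  by rewrite -natrB ?(ltnW j_p) // -subn1 -subnDA.
rewrite /harmonic [in RHS]big_nat_recr //= -/(harmonic j).
have UV : j.+1%:R * j.+1%:R^-1 = 1 :> R by rewrite divrr.
set s : R := (-1) ^+ j; set H := harmonic j; set a : R := j.+1%:R; set b := _^-1.
rewrite exprS -/s -/a.
(* The multiples of [a * b - 1] and of [t * t] are isolated, since both vanish. *)
transitivity (- a * s * (1 - t * H - t * b) + (a * b - 1) * (- s * t) - s * (t * t) * H).
  by ring.
by rewrite pp0 UV; ring.
Qed.

(** At [j = p - 1] the binomial coefficient is [1], and so is the sign because [p] is odd. *)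
Lemma mul_harmonic_pred : t * harmonic p.-1 = 0.
Proof.
have := @bin_pred_prime p.-1; rewrite prednK // => /(_ (leqnn _)).
rewrite binn -signr_odd -subn1 oddB // p_odd expr0 mul1r => /eqP.
by rewrite -subr_eq0 opprB addrC subrK => /eqP.
Qed.

(** Division by [p] gives [m i = p f + r], hence [m i = r (1 + p f / (m i))] as [p ^ 2 = 0]. In the
    product over [i] the remainders permute [1, ..., p - 1] and cancel, leaving [m ^ (p - 1)] on the
    left. *)
Lemma lerch m : coprime p m ->
  t * (\sum_(1 <= i < p) ((m * i) %/ p)%N%:R / i%:R) = m%:R * (m%:R ^+ p.-1 - 1).
Proof.
move=> co_pm; have mU := natU _ co_pm.
have prodU : \prod_(1 <= i < p) (i%:R : R) \is a GRing.unit.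
  by rewrite big_nat_cond; apply: rpred_prod => i; rewrite andbT => /natU_lt.
have key i : (0 < i < p)%N ->
  (m * i)%N%:R = ((m * i) %% p)%N%:R * (1 + t * (((m * i) %/ p)%N%:R / (m%:R * i%:R))) :> R.
  move=> /natU_lt iU; set f := (_ %/ _)%N; set r := (_ %% _)%N.
  have E : (m * i)%N%:R = f%:R * t + r%:R :> R by rewrite -natrM -natrD -divn_eq.
  have miU : (m%:R * i%:R : R) \is a GRing.unit by rewrite unitrM mU iU.
  have rE : r%:R = m%:R * i%:R - f%:R * t :> R by rewrite -natrM E addrC addKr.
  have UV : (m%:R * i%:R) / (m%:R * i%:R) = 1 :> R by rewrite divrr.
  rewrite rE natrM; set x := m%:R * i%:R in UV *; set b := x^-1 in UV *.
  transitivity (x - f%:R * t + f%:R * t * (x * b) - f%:R * f%:R * b * (t * t)); last by ring.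
  by rewrite UV pp0; ring.
have: \prod_(1 <= i < p) (m * i)%N%:R = \prod_(1 <= i < p) i%:R *
   (1 + t * \sum_(1 <= i < p) ((m * i) %/ p)%N%:R / (m%:R * i%:R)) :> R.
  rewrite big_nat_cond.
  under eq_bigr => i do rewrite andbT => /key->.
  rewrite -big_nat_cond big_split prod_Dsq0 //=; congr (_ * _).
  by rewrite -[RHS](perm_big _ (perm_mul_mod p m p_pr co_pm)) big_map.
under eq_bigr => i _ do rewrite natrM.
rewrite big_split big_const_nat iter_mulr_1 subn1 /= [LHS]mulrC => /(mulrI prodU) ->.
rewrite addrC addKr mulrCA; congr (_ * _); rewrite mulr_sumr.
rewrite big_nat_cond [RHS]big_nat_cond; apply: eq_bigr => i.
rewrite andbT => /natU_lt iU; rewrite invrM // mulrCA [_^-1 / _]mulrC mulVKr //.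
Qed.

(** Squaring removes the signs. After exchanging sums, [1 / i] is counted [m - 1 - floor(m i / p)]
    times; the constant part vanishes by [mul_harmonic_pred] and the floors form Lerch's sum. *)
Lemma prod_bin_sqr m : (0 < m)%N -> coprime p m ->
  \prod_(1 <= k < m) 'C(p.-1, ((p * k) %/ m)%N)%:R ^+ 2 =
  1 + 2 * (m%:R * (m%:R ^+ p.-1 - 1)) :> R.
Proof.
move=> m_gt0 co_pm.
have fl_p k : (k < m)%N -> ((p * k) %/ m < p)%N by move=> k_m; rewrite ltn_divLR // ltn_pmul2l.
transitivity (\prod_(1 <= k < m) (1 + t * (-2 * harmonic ((p * k) %/ m)%N)) : R).
  rewrite big_nat_cond [RHS]big_nat_cond; apply: eq_bigr => k.
  rewrite andbT => /andP[_ /fl_p lt_p]; rewrite bin_pred_prime // exprMn sqrr_sign mul1r.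
  set H := harmonic _; transitivity (1 + t * (-2 * H) + (t * t) * H * H); first by ring.
  by rewrite pp0; ring.
rewrite prod_Dsq0 // -mulr_sumr.
have := @sum_lattice R (fun i => i%:R^-1) m p m.-1 p.-1 p_pr co_pm m_gt0.
rewrite !prednK // => /(_ (leqnn _)) ->; last first.
  by move=> k k_m; rewrite -ltnS prednK // fl_p // -(prednK m_gt0) ltnS.
rewrite -lerch //.
have -> : \sum_(1 <= i < p) i%:R^-1 *+ (m.-1 - (m * i) %/ p)%N =
   m.-1%:R * harmonic p.-1 - \sum_(1 <= i < p) ((m * i) %/ p)%N%:R / i%:R.
  rewrite /harmonic prednK // mulr_sumr -sumrB big_nat_cond [RHS]big_nat_cond.
  apply: eq_bigr => i; rewrite andbT => /andP[_ i_p].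
  rewrite mulrnBr ?mulr_natl // -ltnS prednK //.
  by rewrite ltn_divLR // ltn_pmul2l.
set X := \sum_(_ <= _ < _) _.
transitivity (1 + 2 * (t * X) - 2 * m.-1%:R * (t * harmonic p.-1)); first by ring.
by rewrite mul_harmonic_pred; ring.
Qed.


Definition fermat_quotient (q : nat) : nat := ((q ^ p.-1 - 1) %/ p)%N.

Lemma mul_fermat_quotient q : coprime p q ->
  (q ^ p.-1 - 1 = p * fermat_quotient q)%N.
Proof.
move=> co_pq; rewrite mulnC divnK //.
have := @Euler_exp_totient q p; rewrite coprime_sym => /(_ co_pq)/eqP.
by rewrite totient_prime // eqn_mod_dvd // expn_gt0 (coprime_prime_gt0 p q p_pr co_pq).
Qed.

Lemma exp_pred_prime q : coprime p q ->
  q%:R ^+ p.-1 = 1 + t * (fermat_quotient q)%:R :> R.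
Proof.
move=> co_pq; rewrite -natrM -(mul_fermat_quotient q co_pq) natrB; last first.
  by rewrite expn_gt0 (coprime_prime_gt0 p q p_pr co_pq).
by rewrite natrX addrC subrK.
Qed.

Lemma prod_primes n : (0 < n)%N -> n = (\prod_(q <- primes n) q ^ logn q n)%N.
Proof. by move=> n_gt0; rewrite {1}(prod_prime_decomp n_gt0) prime_decompE big_map. Qed.

(** Modulo [p], Fermat quotients behave like logarithms: multiplying factors [1 + p x] adds the
    [x]. *)
Lemma exp_pred_prime_primes m : (0 < m)%N -> coprime p m ->
  m%:R ^+ p.-1 = 1 + t * \sum_(q <- primes m) (logn q m * fermat_quotient q)%N%:R :> R.
Proof.
move=> m_gt0 co_pm; rewrite {1}(prod_primes m m_gt0) natr_prod -prodrXl -prod_Dsq0 //.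
rewrite big_seq [RHS]big_seq; apply: eq_bigr => q; rewrite mem_primes => /and3P[q_pr _ q_m].
rewrite natrX -exprM mulnC exprM exp_pred_prime; last exact: coprime_dvdr q_m co_pm.
elim: (logn q m) => [|v IHv]; first by rewrite mul0n mulr0 addr0.
rewrite exprS IHv mulSn natrD; set x := (fermat_quotient q)%:R; set y := (v * _)%:R.
transitivity (1 + t * (x + y) + (t * t) * x * y); first by ring.
by rewrite pp0; ring.
Qed.

(** The product [F m] of the overview. *)
Definition bin_prod (m : nat) : nat :=
  (\prod_(1 <= k < m | coprime k m) 'C(p.-1, (p * k) %/ m))%N.

(** Both sides have the same product over the divisors of [m]: [prod_bin_sqr] gives the left one,
    [sum_totient_logn] the right one. Inversion then compares single terms. *)
Lemma sqr_bin_prod m : (0 < m)%N -> coprime p m ->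
  (bin_prod m)%:R ^+ 2 =
  1 + t * (2 * \sum_(q <- primes m) (totient_logn q m * fermat_quotient q)%N%:R) :> R.
Proof.
move=> m_gt0 co_pm; move: m co_pm m_gt0.
apply: (@prod_divisors_inj R (coprime p)).
- by move=> m d co_pm /coprime_dvdr->.
- move=> m _ _; set x := 2 * _; apply/unitrPr; exists (1 - t * x).
  by transitivity (1 - t * t * x * x); [ring | rewrite pp0 !mul0r subr0].
move=> m co_pm m_gt0; rewrite prod_Dsq0 //.
transitivity (\prod_(1 <= k < m) ('C(p.-1, ((p * k) %/ m)%N)%:R ^+ 2 : R)).
  rewrite (@big_gcd_classes _ _ _ (fun k m => 'C(p.-1, ((p * k) %/ m)%N)%:R ^+ 2)) //.
    by apply: eq_bigr => d _; rewrite natr_prod prodrXl.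
  by move=> c k n c_gt0; rewrite mulnA divnMr.
rewrite prod_bin_sqr // exp_pred_prime_primes //; congr (1 + _).
rewrite addrC addKr -mulr_sumr.
suff -> : \sum_(d <- divisors m) \sum_(q <- primes d)
     (totient_logn q d * fermat_quotient q)%N%:R
   = m%:R * \sum_(q <- primes m) (logn q m * fermat_quotient q)%N%:R :> R by ring.
(* [totient_logn q d] vanishes when [q] does not divide [d], so the inner range can be made
   independent of [d]. *)
transitivity (\sum_(d <- divisors m) \sum_(q <- primes m)
    (totient_logn q d * fermat_quotient q)%N%:R : R).
  rewrite big_seq [RHS]big_seq; apply: eq_bigr => d; rewrite -dvdn_divisors // => d_m.
  rewrite [RHS](bigID (dvdn^~ d)) /= [X in _ + X]big1 ?addr0 => [|q q_d]; last first.
    by rewrite /totient_logn lognE (negPf q_d) !andbF mul0n sub0n muln0 mul0n.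
  rewrite -[RHS]big_filter; apply: perm_big; apply: uniq_perm.
  - exact: primes_uniq.
  - by rewrite filter_uniq // primes_uniq.
  move=> q; rewrite mem_filter !mem_primes m_gt0 (dvdn_gt0 m_gt0 d_m) /=.
  by case: prime => //=; case q_d: (q %| d)%N => //=; rewrite (dvdn_trans q_d).
rewrite exchange_big mulr_sumr /= big_seq [RHS]big_seq; apply: eq_bigr => q.
rewrite mem_primes => /and3P[q_pr _ _].
by rewrite -natr_sum -big_distrl /= sum_totient_logn // -natrM mulnA.
Qed.

End ModSquare.

(** * Passing to the half range [k < m/2] *)

Lemma big_coprime_half (T : Type) (idx : T) (op : Monoid.com_law idx)
    (F : nat -> T) (m : nat) : 2 < m ->
  \big[op/idx]_(1 <= k < m | coprime k m) F k =
  \big[op/idx]_(1 <= k < m | (2 * k < m) && coprime k m) op (F k) (F (m - k)).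
Proof.
move=> m_gt2; rewrite big_split (bigID (fun k => 2 * k < m)) /=; congr (op _ _).
  by apply: eq_bigl => k; rewrite andbC.
rewrite big_nat_rev /= big_nat_cond [RHS]big_nat_cond; apply: eq_big => k; last first.
  by rewrite add1n subSS.
rewrite add1n subSS; case: (boolP (1 <= k < m)) => //= /andP[k_gt0 k_m].
have -> : coprime (m - k) m = coprime k m.
  by rewrite /coprime -{2}(subnK (ltnW k_m)) gcdnDl -{2}(subnKC (ltnW k_m)) gcdnDl gcdnC.
rewrite andbC; case: (boolP (coprime k m)); rewrite ?andbF ?andbT // => co_km.
(* A [k] prime to [m = 2 * k] would be [1], forcing [m = 2]. *)
have ne : 2 * k != m.
  apply: contraTneq co_km => mE; rewrite -mE /coprime gcdnMl.
  by apply/eqP; lia.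
by lia.
Qed.

Lemma totient_half m : 2 < m ->
  totient m = (\sum_(1 <= k < m | (2 * k < m) && coprime k m) 1).*2.
Proof.
move=> m_gt2; rewrite totient_count_coprime big_ltn ?(ltnW (ltnW m_gt2)) //.
have -> : coprime m 0 = false by rewrite /coprime gcdn0; case: (m) m_gt2 => [|[]].
rewrite add0n -addnn -big_split /= -(@big_coprime_half _ _ _ (fun=> 1)) //.
by rewrite [RHS]big_mkcond /=; apply: eq_bigr => k _; rewrite coprime_sym; case: coprime.
Qed.

(** Since [m] does not divide [p * k], reflecting [k] turns the floor [f] into [p - 1 - f], and
    binomial coefficients are symmetric. *)
Lemma bin_pred_prime_sym p m k : prime p -> coprime p m -> 0 < k < m ->
  'C(p.-1, (p * (m - k)) %/ m) = 'C(p.-1, (p * k) %/ m).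
Proof.
move=> p_pr co_pm /andP[k_gt0 k_m]; have m_gt0 := leq_ltn_trans (leq0n k) k_m.
have p_gt0 := prime_gt0 p_pr.
have f_p : (p * k) %/ m <= p.-1 by rewrite -ltnS prednK // ltn_divLR // ltn_pmul2l.
rewrite -[RHS]bin_sub //; congr (binomial _ _).
have r_gt0 : 0 < (p * k) %% m.
  rewrite lt0n -/(dvdn _ _) Gauss_dvdr 1?coprime_sym //.
  by apply/negP => /(dvdn_leq k_gt0); rewrite leqNgt k_m.
have r_lt := ltn_pmod (p * k) m_gt0; have E := divn_eq (p * k) m.
have -> : p * (m - k) = (p.-1 - (p * k) %/ m) * m + (m - (p * k) %% m).
  move: E f_p r_gt0 r_lt; rewrite mulnBr mulnBl.
  move: ((p * k) %/ m) ((p * k) %% m) => f r E f_p r_gt0 r_lt.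
  have -> : p * m = p.-1 * m + m by rewrite -mulSnr prednK.
  have : f * m <= p.-1 * m by rewrite leq_mul2r f_p orbT.
  by lia.
by rewrite divnMDl // [X in _ + X]divn_small ?addn0 // ltn_subrL r_gt0.
Qed.

(** The half product [H m] of the overview. *)
Definition half_bin_prod (p m : nat) : nat :=
  \prod_(1 <= k < m | (2 * k < m) && coprime k m) 'C(p.-1, (p * k) %/ m).

Lemma bin_prod_half p m : prime p -> coprime p m -> 2 < m ->
  bin_prod p m = half_bin_prod p m ^ 2.
Proof.
move=> p_pr co_pm m_gt2; rewrite /bin_prod big_coprime_half //.
transitivity (\prod_(1 <= k < m | (2 * k < m) && coprime k m) 'C(p.-1, (p * k) %/ m) ^ 2).
  rewrite big_nat_cond [RHS]big_nat_cond; apply: eq_bigr => k /andP[k_m _].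
  by rewrite bin_pred_prime_sym.
by rewrite -mulnn -big_split /=; apply: eq_bigr => k _; rewrite mulnn.
Qed.

Definition floor_sum (p m : nat) : nat :=
  \sum_(1 <= k < m | (2 * k < m) && coprime k m) (p * k) %/ m.

(** Up to sign the half product is [1 + p y], whose fourth power [1 + 4 p y] is known from
    [sqr_bin_prod]; [p] odd makes [2] invertible, which recovers [p y]. *)
Lemma half_bin_prodE (R : comUnitRingType) (p m : nat) :
  prime p -> odd p -> (p%:R * p%:R = 0 :> R)%R ->
  (forall i, coprime p i -> (i%:R : R)%R \is a GRing.unit) ->
  2 < m -> coprime p m ->
  ((half_bin_prod p m)%:R =
   (-1) ^+ floor_sum p m *
   (1 + ((totient m)./2
          * \sum_(q <- primes m) (logn q m * q - logn q m + 1)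
                            * ((q ^ p.-1 - 1) %/ (q - 1)))%N%:R) :> R)%R.
Proof.
move=> p_pr p_odd pp0 natU m_gt2 co_pm; set X := ((_ * _)%N%:R)%R.
have m_gt0 : 0 < m by rewrite (leq_trans _ m_gt2).
have := @sqr_bin_prod R p p_pr p_odd pp0 natU m m_gt0 co_pm.
rewrite bin_prod_half // natrX -exprM.
pose H : R := (- \sum_(1 <= k < m | (2 * k < m)%N && coprime k m)
                 harmonic R ((p * k) %/ m)%N)%R.
have halfE : ((half_bin_prod p m)%:R = (-1) ^+ floor_sum p m * (1 + p%:R * H) :> R)%R.
  rewrite /half_bin_prod natr_prod /H -sumrN -prod_Dsq0 // /floor_sum -prodrXr.
  rewrite -big_split /= big_nat_cond [RHS]big_nat_cond; apply: eq_bigr => k.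
  move=> /andP[/andP[_ k_m] _]; rewrite mulrN (@bin_pred_prime _ _ p_pr) //.
  by rewrite ltn_divLR // ltn_pmul2l // prime_gt0.
rewrite halfE exprMn [((-1) ^+ _ ^+ _)%R]exprM sqrr_sign expr1n mul1r => E.
congr (_ * (1 + _))%R.
have twoU : (2%:R : R)%R \is a GRing.unit.
  by apply: natU; rewrite coprimen2.
have X2 : (X * 2%:R =
    p%:R * \sum_(q <- primes m) (totient_logn q m * fermat_quotient p q)%N%:R)%R.
  rewrite /X -natrM mulnAC muln2 -natr_sum -natrM; congr (_%:R)%R.
  have -> : (totient m)./2.*2 = totient m by rewrite totient_half // doubleK.
  rewrite !big_distrr /= big_seq [RHS]big_seq; apply: eq_bigr => q q_m.
  rewrite totient_logn_fermat // (mul_fermat_quotient p p_pr) ?(mulnCA p) //.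
  by move: q_m; rewrite mem_primes => /and3P[_ _ q_m]; apply: coprime_dvdr q_m co_pm.
apply: (mulIr twoU); rewrite X2; apply: (mulrI twoU); apply: (addrI 1%R).
rewrite [in RHS]mulrCA -E.
transitivity ((1 + p%:R * H) ^+ 4
  - p%:R * p%:R * (6 * H ^+ 2 + 4 * p%:R * H ^+ 3 + (p%:R * p%:R) * H ^+ 4))%R.
  by ring.
by rewrite pp0 mul0r subr0.
Qed.

(** * Gauss's lemma and Euler's criterion in ['F_p] *)

Lemma natr_Fp_eq0 p i : prime p -> (i%:R == 0 :> 'F_p)%R = (p %| i).
Proof. by move=> p_pr; rewrite -val_eqE /= val_Fp_nat. Qed.

Section GaussLemma.
Variable p : nat.
Hypotheses (p_pr : prime p) (p_odd : odd p).
Notation h := (p.-1)./2.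

Let p_gt0 := prime_gt0 p_pr.
Let pE : p = h.*2.+1.
Proof. by rewrite -[LHS]prednK // -[in LHS](odd_double_half p.-1) -subn1 oddB // p_odd. Qed.

Let natF_eq i j : (i%:R == j%:R :> 'F_p)%R = (i == j %[mod p]).
Proof. by rewrite -val_eqE /= !val_Fp_nat. Qed.

(** The distance from [n] to the nearest multiple of [p]. *)
Definition abs_residue (n : nat) : nat := minn (n %% p) (p - n %% p).

(** The sign is a parity: with [p] odd and [r = n %% p], the sum [n + n %/ p + r] is even, and
    replacing [r] by [p - r] flips both parity and sign. *)
Lemma abs_residueE n :
  (n%:R = (-1) ^+ (n + n %/ p + abs_residue n)%N * (abs_residue n)%:R :> 'F_p)%R.
Proof.
have r_lt := ltn_pmod n p_gt0; have E := divn_eq n p.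
rewrite -signr_odd /abs_residue minnE; case: (leqP (n %% p) (p - n %% p)) => rle.
  rewrite (eqP (rle : _ - _ == 0)) subn0 -[in LHS](Fp_nat_mod p_pr).
  suff -> : odd (n + n %/ p + n %% p) = false by rewrite expr0 mul1r.
  by rewrite {1}E !oddD oddM p_odd andbT; case: (odd _); case: (odd _).
have -> : n %% p - (n %% p - (p - n %% p)) = p - n %% p by lia.
rewrite natrB ?(ltnW r_lt) // pchar_Fp_0 // sub0r (Fp_nat_mod p_pr).
suff -> : odd (n + n %/ p + (p - n %% p)) = true by rewrite expr1 mulN1r opprK.
rewrite {1}E !oddD oddB ?(ltnW r_lt) // oddM p_odd andbT.
by case: (odd _); case: (odd _).
Qed.

(** Equal values at [i < j] would force [p] to divide [j - i] or [i + j], both positive and below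
    [p]. *)
Lemma perm_abs_residue m : coprime p m ->
  perm_eq [seq abs_residue (m * j) | j <- index_iota 1 h.+1] (index_iota 1 h.+1).
Proof.
move=> co_pm; apply: perm_map_stable; first exact: iota_uniq.
  have abs_dvd i j : i <= j -> abs_residue (m * i) = abs_residue (m * j) ->
      (p %| j - i) || (p %| i + j).
    move=> le_ij ij; rewrite -(Gauss_dvdr (j - i) co_pm) -(Gauss_dvdr (i + j) co_pm).
    rewrite mulnBr mulnDr -eqn_mod_dvd ?leq_mul2l ?le_ij ?orbT //.
    move: ij; rewrite /abs_residue; have := ltn_pmod (m * i) p_gt0.
    have := ltn_pmod (m * j) p_gt0; rewrite /dvdn -modnDm.
    move: (_ %% p) (_ %% p) => x y x_p y_p xy.
    have [-> | yx] : x = y \/ x + y = p by lia.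
      by rewrite eqxx.
    by rewrite yx modnn orbT.
  have le_inj i j : i <= j -> 0 < i -> j < h.+1 ->
      abs_residue (m * i) = abs_residue (m * j) -> i = j.
    move=> le_ij i_gt0 j_h /(abs_dvd _ _ le_ij) /orP[|/dvdn_leq]; last by lia.
    by case: (posnP (j - i)) => [|ji_gt0 /(dvdn_leq ji_gt0)]; lia.
  move=> i j; rewrite !mem_index_iota => /andP[i0 i_h] /andP[j0 j_h] ij.
  by case: (leqP i j) => [le_ij|/ltnW le_ji]; [|symmetry]; apply: le_inj.
move=> j; rewrite !mem_index_iota /abs_residue => /andP[j_gt0 j_h].
have r_lt := ltn_pmod (m * j) p_gt0.
have : 0 < (m * j) %% p.
  rewrite lt0n -/(dvdn _ _) Gauss_dvdr //; apply/negP => /(dvdn_leq j_gt0).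
  by lia.
by lia.
Qed.

(** Multiply [abs_residueE] over the half range and cancel [h!]. The absolute residues permute
    [1, ..., h], so their sum merges with that of the [m j] into the [m.+1] term; [m] may be
    even. *)
Lemma gauss_lemma m : coprime p m ->
  (m%:R ^+ h = (-1) ^+ (m.+1 * (\sum_(1 <= j < h.+1) j) +
                        \sum_(1 <= j < h.+1) (m * j) %/ p)%N :> 'F_p)%R.
Proof.
move=> co_pm.
have nz : (\prod_(1 <= j < h.+1) j%:R != 0 :> 'F_p)%R.
  rewrite prodf_seq_neq0; apply/allP => j; rewrite mem_index_iota /= natr_Fp_eq0 //.
  by move=> /andP[j_gt0 j_h]; apply/negP => /(dvdn_leq j_gt0); lia.
apply: (mulIf nz).
transitivity (\prod_(1 <= j < h.+1) (m * j)%N%:R : 'F_p)%R.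
  under [RHS]eq_bigr => j _ do rewrite natrM.
  by rewrite big_split big_const_nat iter_mulr_1 subn1.
under eq_bigr => j _ do rewrite abs_residueE.
rewrite big_split prodrXr /=; congr (_ * _)%R.
  rewrite !big_split /= -(big_map (fun j => abs_residue (m * j)) xpredT id).
  rewrite (perm_big _ (perm_abs_residue _ co_pm)) /= -big_distrr /=.
  by rewrite addnAC mulSnr.
rewrite -(big_map (fun j => abs_residue (m * j)) xpredT (fun i => i%:R : 'F_p)%R).
exact: perm_big (perm_abs_residue _ co_pm).
Qed.

Lemma gauss_lemma_2 : (2%:R ^+ h = (-1) ^+ (\sum_(1 <= j < h.+1) j)%N :> 'F_p)%R.
Proof.
rewrite gauss_lemma ?coprimen2 //.
(* All floors vanish since [2 j < p], and the coefficient [3] is odd. *)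
rewrite [X in _ + X]big_nat_cond [X in _ + X]big1 ?addn0 => [|j /andP[/andP[_ j_h] _]].
  by rewrite -signr_odd oddM /= signr_odd.
by rewrite divn_small //; lia.
Qed.

Lemma euler_criterion a : coprime p a ->
  ((legendre a p)%:~R = a%:R ^+ h :> 'F_p)%R.
Proof.
move=> co_pa; have nd : ~~ (p %| a) by rewrite -prime_coprime.
have fermat n : ~~ (p %| n) -> (n%:R ^+ h ^+ 2 = 1 :> 'F_p)%R.
  move=> p_n; apply/eqP; rewrite -exprM muln2 -natrX (natF_eq _ 1).
  have -> : h.*2 = totient p by rewrite totient_prime // [in RHS]pE.
  by apply/eqP/Euler_exp_totient; rewrite coprime_sym prime_coprime.
rewrite /legendre (negPf nd); case: existsP => [[x /eqP xE]|nex].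
  have -> : (a%:R = x%:R ^+ 2 :> 'F_p)%R.
    by rewrite -natrX -[LHS](Fp_nat_mod p_pr) -xE Fp_nat_mod // mulnn.
  rewrite -exprM mulnC exprM fermat //; apply: contra nd => p_x.
  by rewrite /dvdn -xE -/(dvdn _ _) dvdn_mulr.
have /eqP := fermat _ nd; rewrite sqrf_eq1 => /orP[/eqP x1|/eqP->]; last by rewrite mulrN1z.
exfalso.
(* A nonsquare [a] with [a ^ h = 1] would join the squares [1, 4, ..., h ^ 2] to make [h + 1]
   distinct roots of [X ^ h - 1]. *)
pose rs := (a%:R : 'F_p)%R :: [seq (j%:R ^+ 2)%R | j <- index_iota 1 h.+1].
have h_gt0 : 0 < h by have := prime_gt1 p_pr; lia.
have nzP : ('X^h - 1 != 0 :> {poly 'F_p})%R.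
  by rewrite -size_poly_eq0 size_XnsubC.
have roots_rs : all (root ('X^h - 1)) rs.
  rewrite /= rootE !hornerE x1 subrr eqxx /=; apply/allP => _ /mapP[j j_in ->].
  rewrite rootE !hornerE -exprM mulnC exprM fermat ?subrr //.
  move: j_in; rewrite mem_index_iota => /andP[j_gt0 j_h].
  by apply/negP => /(dvdn_leq j_gt0); lia.
have uniq_rs : uniq rs.
  rewrite /=; apply/andP; split.
    apply/mapP => -[j]; rewrite mem_index_iota => /andP[j_gt0 j_h] /eqP.
    rewrite -natrX natF_eq => /eqP aE; apply: nex.
    have j_p : j < p by lia.
    by exists (Ordinal j_p); rewrite /= mulnn aE.
  rewrite map_inj_in_uniq ?iota_uniq // => i j; rewrite !mem_index_iota.
  move=> /andP[i_gt0 i_h] /andP[j_gt0 j_h] /eqP; rewrite eqf_sqr => /orP[].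
    by rewrite natF_eq !modn_small => [/eqP||]; lia.
  rewrite -subr_eq0 opprK -natrD natr_Fp_eq0 // => /dvdn_leq; lia.
have := max_poly_roots nzP roots_rs uniq_rs.
by rewrite size_XnsubC // /rs /= size_map size_iota subn1 /= ltnn.
Qed.

End GaussLemma.

(* The value at [2] is [1] because no [0 < k < 2/2] exists: the half sums for
   the divisor [2] are empty, so they carry no Legendre symbol. *)
Definition odd_mangoldt (d : nat) : nat := if d == 2 then 1 else exp_mangoldt d.

Lemma prod_odd_mangoldt m : 0 < m ->
  (\prod_(d <- divisors m) odd_mangoldt d) * (if odd m then 1 else 2) = m.
Proof.
move=> m_gt0; rewrite -[RHS](prod_exp_mangoldt m m_gt0).
have [m_odd|m_even] := boolP (odd m).
  rewrite muln1 big_seq [RHS]big_seq; apply: eq_bigr => d; rewrite -dvdn_divisors //.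
  by rewrite /odd_mangoldt; case: eqP => // ->; rewrite dvdn2 m_odd.
have m2 : 2 \in divisors m by rewrite -dvdn_divisors // dvdn2.
rewrite (bigD1_seq 2) ?divisors_uniq //= [RHS](bigD1_seq 2) ?divisors_uniq //=.
rewrite mul1n mulnC; congr (_ * _).
by apply: eq_bigr => d /negPf d2; rewrite /odd_mangoldt d2.
Qed.

Lemma sum_half_range (V : nmodType) (F : nat -> V) m : 0 < m ->
  (\sum_(1 <= k < m | (2 * k < m)%N) F k = \sum_(1 <= k < (m.-1)./2.+1) F k)%R.
Proof.
move=> m_gt0; rewrite (@big_nat_widen _ _ _ 1 (m.-1)./2.+1 m) /=; last by lia.
by apply: eq_bigl => k; lia.
Qed.

(** * The sign of the half product *)

Section Sign.
Variable p : nat.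
Hypotheses (p_pr : prime p) (p_odd : odd p).
Notation h := (p.-1)./2.

(** Counts the lattice points of a rectangle on the two sides of the line of slope [p / m], as in
    quadratic reciprocity; here [m] may be even. *)
Lemma sum_floor_reciprocity m : coprime p m ->
  \sum_(1 <= k < m | 2 * k < m) (p * k) %/ m + \sum_(1 <= j < h.+1) (m * j) %/ p =
  (m.-1)./2 * h.
Proof.
move=> co_pm; have p_gt0 := prime_gt0 p_pr.
have m_gt0 := coprime_prime_gt0 p m p_pr co_pm.
have pE : p = h.*2.+1 by lia.
rewrite sum_half_range //.
have h_p : h < p by lia.
have p_le k : k <= (m.-1)./2 -> (p * k) %/ m <= h.
  move=> k_m; rewrite -ltnS ltn_divLR // -(ltn_pmul2l (isT : 0 < 2)).
  have : p * (2 * k) <= p * m.-1 by rewrite leq_mul2l; lia.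
  have : p * m.-1 + p = p * m by rewrite -mulnSr prednK.
  have : h.+1 * m * 2 = p * m + m by rewrite {2}pE -muln2; ring.
  by lia.
(* This bound makes the truncated subtraction below exact. *)
have m_le j : 1 <= j < h.+1 -> (m * j) %/ p <= (m.-1)./2.
  move=> /andP[_ j_h]; rewrite -ltnS ltn_divLR // -(ltn_pmul2l (isT : 0 < 2)).
  have : m * (2 * j) <= m * p.-1 by rewrite leq_mul2l; lia.
  have : m * p.-1 + m = m * p by rewrite -mulnSr prednK.
  have : m * p <= ((m.-1)./2.+1 * 2) * p by rewrite leq_mul2r; lia.
  by lia.
have -> : \sum_(1 <= k < (m.-1)./2.+1) (p * k) %/ m =
          \sum_(1 <= j < h.+1) ((m.-1)./2 - (m * j) %/ p).
  transitivity (\sum_(1 <= k < (m.-1)./2.+1) \sum_(1 <= i < ((p * k) %/ m).+1) 1).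
    by apply: eq_bigr => k _; rewrite sum_nat_const_nat subn1 muln1.
  apply: etrans (@sum_lattice nat (fun=> 1) m p _ h p_pr co_pm m_gt0 h_p p_le) _.
  by apply: eq_bigr => j _; apply: natn.
rewrite -big_split /=.
rewrite (eq_big_nat _ _ (F2 := fun=> (m.-1)./2)); last by move=> j /m_le/subnK.
by rewrite sum_nat_const_nat subn1 mulnC.
Qed.

Lemma exp_mangoldt_dvd m : 0 < m -> exp_mangoldt m %| m.
Proof.
move=> m_gt0; rewrite -{2}(prod_exp_mangoldt m m_gt0).
by rewrite (bigD1_seq m) ?divisors_id ?divisors_uniq //= dvdn_mulr.
Qed.

(** Multiplied over the divisors of [m], the left side involves the floors for all [k < m/2], which
    reciprocity and Gauss's lemma evaluate; inversion returns to [m] itself. *)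
Lemma sign_floor_sum m : coprime p m -> 2 < m ->
  ((-1) ^+ floor_sum p m =
   (-1) ^+ ((totient m)./2 * h) * (exp_mangoldt m)%:R ^+ h :> 'F_p)%R.
Proof.
move=> co_pm m_gt2; have m_gt0 : 0 < m by rewrite (leq_trans _ m_gt2).
pose n d := \sum_(1 <= k < d | (2 * k < d) && coprime k d) 1.
have natU d : coprime p d -> (d%:R : 'F_p)%R \is a GRing.unit by rewrite unitFpE.
(* Inversion also visits the divisor [2], where only [odd_mangoldt] has the right value. *)
have -> : exp_mangoldt m = odd_mangoldt m.
  by rewrite /odd_mangoldt; case: eqP m_gt2 => // ->.
rewrite totient_half // doubleK -/(n m).
apply: (@prod_divisors_inj _ (coprime p) (fun m => (-1) ^+ floor_sum p m)%R
          (fun m => (-1) ^+ (n m * h) * (odd_mangoldt m)%:R ^+ h)%R) => //.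
- by move=> a d co_pa /coprime_dvdr->.
- move=> a co_pa a_gt0; rewrite unitrM !unitrX ?unitrN1 // natU //.
  rewrite /odd_mangoldt; case: eqP => _; first exact: coprimen1.
  exact: coprime_dvdr (exp_mangoldt_dvd a a_gt0) co_pa.
move=> {}m {m_gt2} co_pm {}m_gt0.
have classes (f : nat -> nat -> nat) :
    (forall c k d, 0 < c -> f (k * c) (d * c) = f k d) ->
  \sum_(d <- divisors m) \sum_(1 <= k < d | (2 * k < d) && coprime k d) f k d =
  \sum_(1 <= k < m | 2 * k < m) f k m.
  move=> fE; rewrite [RHS]big_mkcond /=.
  rewrite (@big_gcd_classes _ _ _ (fun k m => if 2 * k < m then f k m else 0)) //.
    by apply: eq_bigr => d _; rewrite -big_mkcondl.
  by move=> c k d c_gt0; rewrite mulnA ltn_pmul2r // fE.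
rewrite prodrXr classes; last by move=> c k d c_gt0; rewrite mulnA divnMr.
rewrite big_split prodrXr -big_distrl classes //= prodrXl -natr_prod.
have -> : \sum_(1 <= k < m | 2 * k < m) 1 = (m.-1)./2.
  by rewrite sum_half_range // sum_nat_const_nat subn1 muln1.
have rec := sum_floor_reciprocity m co_pm.
have gauss := gauss_lemma p p_pr p_odd m co_pm.
have gauss2 := gauss_lemma_2 p p_pr p_odd.
move: gauss; rewrite -{1}(prod_odd_mangoldt m m_gt0) -rec.
set E := \sum_(1 <= k < m | _) _; set E' := \sum_(1 <= j < _) _ %/ _.
set T := \sum_(1 <= j < _) j in gauss2 *; set L := \prod_(_ <- _) _.
rewrite natrM exprMn => gauss.
(* By reciprocity the other sign has exponent [E + E']. *)
suff -> : (L%:R ^+ h = (-1) ^+ E' :> 'F_p)%R.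
  by rewrite -exprD -addnA addnn -[RHS]signr_odd oddD odd_double addbF signr_odd.
(* For odd [m] the coefficient [m + 1] is even; for even [m] it is odd and its sign cancels
   [2 ^ h]. *)
case m_odd : (odd m) gauss => /=.
  rewrite expr1n mulr1 => ->.
  by rewrite -[LHS]signr_odd oddD oddM /= m_odd /= signr_odd.
rewrite gauss2 exprD -[((-1) ^+ (_ * _))%R]signr_odd oddM /= m_odd /= signr_odd mulrC.
by apply: mulrI; rewrite unitrX ?unitrN1.
Qed.

(** The product is one of [0], [1], [-1], and these are distinct modulo [p > 2]; its value in ['F_p]
    comes from [sign_floor_sum] and Euler's criterion. *)
Lemma sign_legendre m : coprime p m -> 2 < m ->
  ((-1) ^+ ((totient m)./2 * h)%N * legendre (head 0 (primes m)) p ^+ (size (primes m) == 1)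
     * (-1) ^+ floor_sum p m = 1)%R.
Proof.
move=> co_pm m_gt2; have m_gt0 : 0 < m by rewrite (leq_trans _ m_gt2).
set s := (_ * _ * _)%R.
have sF : (s%:~R = 1 :> 'F_p)%R.
  rewrite /s !intrM !rmorphXn /= rmorphN1.
  have -> : ((legendre (head 0 (primes m)) p)%:~R ^+ (size (primes m) == 1%N)
    = (exp_mangoldt m)%:R ^+ h :> 'F_p)%R.
    rewrite /exp_mangoldt; case: eqP => [sz1|]; last by rewrite expr0 expr1n.
    rewrite expr1 euler_criterion //.
    have : head 0 (primes m) \in primes m.
      by case: (primes m) sz1 => //= q s0; rewrite mem_head.
    by rewrite mem_primes => /and3P[_ _ q_m]; apply: coprime_dvdr q_m co_pm.
  by rewrite -sign_floor_sum // -expr2 sqrr_sign.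
have : [\/ s = 0, s = 1 | s = -1]%R.
  rewrite /s -signr_odd -[((-1) ^+ floor_sum p m)%R]signr_odd /legendre.
  case: (odd _); case: (odd _); case: (_ == 1); case: ifP => _; try case: ifP => _;
    by [apply: Or31 | apply: Or32 | apply: Or33].
case=> // sE; move: sF; rewrite sE.
  by move/esym/eqP; rewrite oner_eq0.
move/eqP; rewrite rmorphN1 eq_sym -subr_eq0 opprK -(natrD _ 1 1).
rewrite natr_Fp_eq0 // => /(@dvdn_leq p 2 isT).
by case: p p_pr p_odd => [|[|[|]]].
Qed.

End Sign.

(** * From ['Z_(p ^ 2)] back to integer congruences *)

Lemma intr_Zp_eq0 n (x : int) : 1 < n -> (x%:~R = 0 :> 'Z_n)%R -> (n%:Z %| x)%Z.
Proof.
move=> n_gt1; rewrite dvdzE /=; case: x => k.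
  by move/(congr1 val); rewrite /= val_Zp_nat // => /eqP.
rewrite NegzE mulrNz => /eqP; rewrite oppr_eq0 => /eqP/(congr1 val).
by rewrite /= val_Zp_nat // => /eqP.
Qed.

Theorem theorem1p2 (m p : nat) :
  2 < m -> prime p -> odd p -> ~~ (p %| m) ->
  let ps := primes m in
  let r := size ps in
  let lhs : int :=
    ((-1) ^+ ((totient m)./2 * (p.-1)./2)
     * (legendre (head 0 ps) p) ^+ (r == 1)
     * (\prod_(1 <= k < m | (2 * k < m) && coprime k m)
           'C(p.-1, (p * k) %/ m))%N%:Z)%R in
  let rhs : int :=
    (1 + ((totient m)./2
          * \sum_(q <- ps) (logn q m * q - logn q m + 1)
                            * ((q ^ p.-1 - 1) %/ (q - 1)))%N%:Z)%R in
  (lhs = rhs %[mod (p ^ 2)%:Z])%Z.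
Proof.
move=> m_gt2 p_pr p_odd p_m ps r lhs rhs.
have co_pm : coprime p m by rewrite prime_coprime.
have p2_gt1 : 1 < p ^ 2 by rewrite (ltn_exp2l 0) ?prime_gt1.
have pp0 : (p%:R * p%:R = 0 :> 'Z_(p ^ 2))%R.
  by rewrite -natrM mulnn pchar_Zp.
have natU i : coprime p i -> (i%:R : 'Z_(p ^ 2))%R \is a GRing.unit.
  by move=> co_pi; rewrite unitZpE // coprimeXl.
apply/eqP; rewrite eqz_mod_dvd; apply: intr_Zp_eq0 => //.
rewrite /lhs /rhs -/(half_bin_prod p m) intrB intrM intrD.
rewrite -[(Posz (half_bin_prod p m))%:~R%R]/((half_bin_prod p m)%:R)%R.
rewrite (half_bin_prodE _ p m p_pr p_odd pp0 natU m_gt2 co_pm) mulrA.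
rewrite -[((-1) ^+ floor_sum p m)%R](rmorph_sign intr) -intrM sign_legendre //.
by rewrite mul1r subrr.
Qed.
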